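(* Let $A\in\mathbb{R}^{m\times n_x}$, $B\in\mathbb{R}^{m\times n_y}$, $b\in\mathbb{R}^m$, and consider $$\min_{x,y,z}\ F(x)+G(y)+\iota_{\mathbb{R}_+^m}(z)\quad\text{s.t.}\quad Ax+By+z=b .$$ Suppose that $F:\mathbb{R}^{n_x}\to\mathbb{R}$ and $G:\mathbb{R}^{n_y}\to\mathbb{R}$ are continuously differentiable, respectively $\mu_F$- and $\mu_G$-strongly convex, and have $L_F$- and $L_G$-Lipschitz gradients, where $\mu_F,\mu_G>0$ and $L_F,L_G<\infty$. Assume also that the matrix $[A\ B]$ has full row rank. Then for every fixed $\beta>0$ there exists a problem-dependent $\bar\tau>0$ such that, for every $0<\tau<\bar\tau$, the direct $x\to y\to z\to\lambda$ ADMM iteration with penalty $\beta$ and multiplier step $\tau$ (described in the context) converges R-linearly, from every finite initialization $(x^0,y^0,z^0,\lambda^0)$ satisfying $z^0\in\mathbb{R}_+^m$, to the unique KKT point.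
   Context: $\iota_C$ is the indicator function of $C$. The augmented Lagrangian is $$\mathcal L_\beta(x,y,z,\lambda)=F(x)+G(y)+\iota_{\mathbb{R}_+^m}(z)-\lambda^\top r+\tfrac{\beta}{2}\|r\|^2,\qquad r=Ax+By+z-b .$$ The direct ADMM iteration with penalty $\beta>0$ and multiplier step $\tau>0$ is $$x^{k+1}\in\operatorname{argmin}_x\mathcal L_\beta(x,y^k,z^k,\lambda^k),\quad y^{k+1}\in\operatorname{argmin}_y\mathcal L_\beta(x^{k+1},y,z^k,\lambda^k),\quad z^{k+1}\in\operatorname{argmin}_z\mathcal L_\beta(x^{k+1},y^{k+1},z,\lambda^k),$$ $$\lambda^{k+1}=\lambda^k-\tau(Ax^{k+1}+By^{k+1}+z^{k+1}-b).$$ A KKT point is $(x^\star,y^\star,z^\star,\lambda^\star)$ with $A^\top\lambda^\star=\nabla F(x^\star)$, $B^\top\lambda^\star=\nabla G(y^\star)$, $Ax^\star+By^\star+z^\star=b$, $z^\star\in\mathbb{R}_+^m$, $\lambda^\star\in N_{\mathbb{R}_+^m}(z^\star)$ (normal cone). ''Problem-dependent'' means that $\bar\tau$ may depend on $F,G,A,B,b$ and $\beta$ but not on the initialization. R-linear convergence of a sequence $w^k$ to $w^\star$ means $\|w^k-w^\star\|\le C\rho^k$ for some $C<\infty$ and $\rho\in(0,1)$. *)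

(* Defs.v *)
From HB Require Import structures.
From mathcomp Require Import all_boot all_order all_algebra.
From mathcomp Require Import all_classical all_reals all_analysis.

Set Implicit Arguments.
Unset Strict Implicit.
Unset Printing Implicit Defensive.

Import Order.TTheory GRing.Theory Num.Theory.
Import numFieldNormedType.Exports.

Local Open Scope classical_set_scope.
Local Open Scope ring_scope.

Section Euclidean.
Context {R : realType} {n : nat}.
Implicit Types u v x y : 'cV[R]_n.

Definition dot u v : R := \sum_(i < n) u i 0 * v i 0.

(* The library norm `|u| on matrices is the sup norm; strong convexity and
   Lipschitz constants are measured in the Euclidean norm instead. *)
Definition enorm u : R := Num.sqrt (dot u u).

(* Meaningful only where f is differentiable ('D is total). *)
Definition grad (f : 'cV[R]_n -> R) x : 'cV[R]_n :=
  \col_(i < n) 'D_(delta_mx i 0) f x.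

Definition cont_differentiable (f : 'cV[R]_n -> R) : Prop :=
  (forall x, differentiable f x) /\ continuous (grad f).

Definition strongly_convex (mu : R) (f : 'cV[R]_n -> R) : Prop :=
  forall x y (t : R), 0 <= t <= 1 ->
    f (t *: x + (1 - t) *: y) <=
      t * f x + (1 - t) * f y - mu / 2 * (t * (1 - t)) * enorm (x - y) ^+ 2.

Definition lipschitz_grad (L : R) (f : 'cV[R]_n -> R) : Prop :=
  forall x y, enorm (grad f x - grad f y) <= L * enorm (x - y).

Definition nonneg_orthant : set 'cV[R]_n := [set z | forall i, 0 <= z i 0].

Definition indicator (C : set 'cV[R]_n) (z : 'cV[R]_n) : \bar R :=
  if z \in C then 0%E else +oo%E.

Definition normal_cone (C : set 'cV[R]_n) (z : 'cV[R]_n) : set 'cV[R]_n :=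
  [set v | C z /\ forall w, C w -> dot v (w - z) <= 0].

Definition R_linear_cvg (w : nat -> 'cV[R]_n) (wstar : 'cV[R]_n) : Prop :=
  exists C rho : R, 0 < rho < 1 /\
    forall k, enorm (w k - wstar) <= C * rho ^+ k.

End Euclidean.

Definition argmin {R : realType} {T : Type} (f : T -> \bar R) : set T :=
  [set x | forall y, (f x <= f y)%E].

Record pd_point (R : realType) (nx ny m : nat) := PDPoint {
  px : 'cV[R]_nx;
  py : 'cV[R]_ny;
  pz : 'cV[R]_m;
  plam : 'cV[R]_m
}.

Definition stack {R : realType} {nx ny m : nat} (w : pd_point R nx ny m) :
    'cV[R]_((nx + ny) + (m + m)) :=
  col_mx (col_mx (px w) (py w)) (col_mx (pz w) (plam w)).

Section ADMM.
Context {R : realType} {nx ny m : nat}.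
Variables (F : 'cV[R]_nx -> R) (G : 'cV[R]_ny -> R).
Variables (A : 'M[R]_(m, nx)) (B : 'M[R]_(m, ny)) (b : 'cV[R]_m).

Definition residual (x : 'cV[R]_nx) (y : 'cV[R]_ny) (z : 'cV[R]_m) : 'cV[R]_m :=
  A *m x + B *m y + z - b.

Definition aug_lagrangian (beta : R) (x : 'cV[R]_nx) (y : 'cV[R]_ny)
    (z lam : 'cV[R]_m) : \bar R :=
  let r := residual x y z in
  ((F x)%:E + (G y)%:E + indicator nonneg_orthant z
   - (dot lam r)%:E + (beta / 2 * enorm r ^+ 2)%:E)%E.

Definition admm_step (beta tau : R) (w w' : pd_point R nx ny m) : Prop :=
  [/\ argmin (fun x => aug_lagrangian beta x (py w) (pz w) (plam w)) (px w'),
      argmin (fun y => aug_lagrangian beta (px w') y (pz w) (plam w)) (py w'),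
      argmin (fun z => aug_lagrangian beta (px w') (py w') z (plam w)) (pz w')
    & plam w' = plam w - tau *: residual (px w') (py w') (pz w')].

Definition admm_run (beta tau : R) (w0 : pd_point R nx ny m)
    (w : nat -> pd_point R nx ny m) : Prop :=
  w 0%N = w0 /\ forall k, admm_step beta tau (w k) (w k.+1).

Definition is_kkt (w : pd_point R nx ny m) : Prop :=
  [/\ A^T *m plam w = grad F (px w),
      B^T *m plam w = grad G (py w),
      A *m px w + B *m py w + pz w = b,
      nonneg_orthant (pz w)
    & normal_cone nonneg_orthant (pz w) (plam w)].

End ADMM.

(* Main.v *)
Require Import Defs.
From HB Require Import structures.
From mathcomp Require Import all_boot all_order all_algebra.
From mathcomp Require Import all_classical all_reals all_analysis.
From mathcomp Require Import ring lra.

(** For a fixed multiplier [lam], put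
      L(w; lam) = F x + G y - <lam, r> + beta/2 |r|^2,  r = A x + B y + z - b,
    on [z >= 0], and let [d lam] be its minimum, attained at [v].  Strong
    convexity of [F] and [G] makes [L] grow quadratically in [x], [y] and [r]
    away from [v], and [d] is a smooth concave function with gradient [- r v].
    One iteration is a block-coordinate sweep on [L(.; lam)] followed by a short
    gradient step on [- d], so the method is an inexact dual gradient ascent.
    Progress is measured by the sum of a primal and a dual gap,
      Phi = (L(w; lam) - d lam) + (max d - d lam)
          = L(w; lam) + L(wstar; lam) - 2 d lam,
    where [max d = L(wstar; lam)] because the residual of the KKT point is zero.
    Four facts make [Phi] contract.
    - A sweep multiplies the primal gap by some [kappa / (1 + kappa) < 1]: its
      cost-to-go is bounded by the distance it travelled, which its decrease
      bounds in turn ([sweep_descent], [sweep_cost_to_go]).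
    - [d] satisfies the ascent inequality of a function with [1/beta]-Lipschitz
      gradient ([dual_ascent]).
    - The dual gap is at most [C |r v|^2] ([dual_gap_upper]).  The full row
      rank enters here: the inner solution [v] solves the KKT system with [b]
      shifted by [r v], and the multiplier of that system is a Lipschitz
      function of the shift ([multiplier_lipschitz]).
    - In the balance of the multiplier step the cross terms combine into
      tau (|r w' - r v|^2 - |r v|^2), up to a term of order tau^2.  The first
      square is absorbed by the contraction of the sweep when [tau] is small,
      and the second one decreases the dual gap ([lyapunov_contraction]).
    Finally [Phi] dominates the squared distance to the KKT point
    ([lyapunov_error]).  No constant involves the starting point, so the bound
    on [tau] depends on the problem data and [beta] only.

    All existence statements (KKT point, inner solutions, block minimisers) are
    instances of one result, [polyhedral_kkt]: a smooth strongly convex function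
    on [{u | K u <= b}], with [K] right invertible, has a minimiser with a
    multiplier. *)

Set Implicit Arguments.
Unset Strict Implicit.
Unset Printing Implicit Defensive.

Import Order.TTheory GRing.Theory Num.Theory.
Import numFieldNormedType.Exports.

Local Open Scope ring_scope.

(** * Euclidean inner product *)

Definition sqn {R : realType} {n : nat} (u : 'cV[R]_n) : R := dot u u.

Lemma entry_addE (R : realType) m n (M N : 'M[R]_(m, n)) i j :
  (M + N) i j = M i j + N i j.
Proof. by rewrite mxE. Qed.

Lemma entry_oppE (R : realType) m n (M : 'M[R]_(m, n)) i j :
  (- M) i j = - M i j.
Proof. by rewrite mxE. Qed.

Lemma entry_scaleE (R : realType) m n a (M : 'M[R]_(m, n)) i j :
  (a *: M) i j = a * M i j.
Proof. by rewrite mxE. Qed.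

Lemma entry_0E (R : realType) m n i j : (0 : 'M[R]_(m, n)) i j = 0.
Proof. by rewrite mxE. Qed.

Definition entryE := (entry_addE, entry_oppE, entry_scaleE,
  entry_0E).

(** Linear identities between vectors, products [M *m u] being opaque. *)
Ltac vec_ring := apply/matrixP => ? ?; rewrite !entryE; ring.

Ltac positivity := repeat first
  [ assumption | exact: ltr0Sn | rewrite invr_gt0 | apply: mulr_gt0
  | apply: addr_gt0 | apply: exprn_gt0 ].

Section Dot.
Context {R : realType}.

Lemma dotC n (u v : 'cV[R]_n) : dot u v = dot v u.
Proof. by apply: eq_bigr => i _; rewrite mulrC. Qed.

Lemma dotDl n (u v w : 'cV[R]_n) : dot (u + v) w = dot u w + dot v w.
Proof.
by rewrite /dot -big_split; apply: eq_bigr => i _; rewrite mxE mulrDl.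
Qed.

Lemma dotZl n a (u v : 'cV[R]_n) : dot (a *: u) v = a * dot u v.
Proof. by rewrite /dot mulr_sumr; apply: eq_bigr => i _; rewrite mxE mulrA. Qed.

Lemma dotNl n (u v : 'cV[R]_n) : dot (- u) v = - dot u v.
Proof. by rewrite -scaleN1r dotZl mulN1r. Qed.

Lemma dotDr n (u v w : 'cV[R]_n) : dot w (u + v) = dot w u + dot w v.
Proof. by rewrite dotC dotDl !(dotC w). Qed.

Lemma dotZr n a (u v : 'cV[R]_n) : dot u (a *: v) = a * dot u v.
Proof. by rewrite dotC dotZl dotC. Qed.

Lemma dotNr n (u v : 'cV[R]_n) : dot u (- v) = - dot u v.
Proof. by rewrite dotC dotNl dotC. Qed.

Lemma dot0l n (u : 'cV[R]_n) : dot 0 u = 0.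
Proof. by rewrite /dot big1 // => i _; rewrite mxE mul0r. Qed.

Lemma dot0r n (u : 'cV[R]_n) : dot u 0 = 0.
Proof. by rewrite dotC dot0l. Qed.

Definition dotE := (dotDl, dotDr, dotNl, dotNr, dotZl, dotZr).

Lemma dot_mulmx m n (M : 'M[R]_(m, n)) u v :
  dot (M *m u) v = dot u (M^T *m v).
Proof.
have dotmx k (a b : 'cV[R]_k) : dot a b = (a^T *m b) 0 0.
  by rewrite mxE; apply: eq_bigr => i _; rewrite mxE.
by rewrite !dotmx trmx_mul mulmxA.
Qed.

Lemma dot_col_mx m n (a c : 'cV[R]_m) (b d : 'cV[R]_n) :
  dot (col_mx a b) (col_mx c d) = dot a c + dot b d.
Proof.
by rewrite /dot big_split_ord; congr (_ + _); apply: eq_bigr => i _;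
  rewrite ?col_mxEu ?col_mxEd.
Qed.

Lemma sqn_ge0 n (u : 'cV[R]_n) : 0 <= sqn u.
Proof. by apply: sumr_ge0 => i _; rewrite -expr2 sqr_ge0. Qed.

Lemma sqn_eq0 n (u : 'cV[R]_n) : sqn u <= 0 -> u = 0.
Proof.
move=> u0; apply/colP => i; rewrite mxE.
have /eqP : sqn u = 0 by apply/eqP; rewrite eq_le u0 sqn_ge0.
rewrite psumr_eq0 => [/allP/(_ i (mem_index_enum _))|j _].
  by rewrite -expr2 sqrf_eq0 => /eqP.
by rewrite -expr2 sqr_ge0.
Qed.

Lemma sqn0 n : sqn (0 : 'cV[R]_n) = 0.
Proof. exact: dot0l. Qed.

Lemma sqnN n (u : 'cV[R]_n) : sqn (- u) = sqn u.
Proof. by rewrite /sqn !dotE opprK. Qed.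

Lemma sqnZ n a (u : 'cV[R]_n) : sqn (a *: u) = a ^+ 2 * sqn u.
Proof. by rewrite /sqn !dotE mulrA. Qed.

Lemma sqnD n (u v : 'cV[R]_n) : sqn (u + v) = sqn u + 2 * dot u v + sqn v.
Proof. by rewrite /sqn !dotE (dotC v u); ring. Qed.

Lemma sqnBC n (u v : 'cV[R]_n) : sqn (u - v) = sqn (v - u).
Proof. by rewrite -sqnN opprB. Qed.

Lemma sqnD_le n (u v : 'cV[R]_n) : sqn (u + v) <= 2 * sqn u + 2 * sqn v.
Proof.
by have := sqn_ge0 (u - v); rewrite !sqnD sqnN dotNr; lra.
Qed.

Lemma sqn_triangle n (u v w : 'cV[R]_n) :
  sqn (u - w) <= 2 * sqn (u - v) + 2 * sqn (w - v).
Proof.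
have -> : u - w = (u - v) - (w - v) by vec_ring.
by apply: le_trans (sqnD_le _ _) _; rewrite sqnN.
Qed.

Lemma sqn_col_mx m n (a : 'cV[R]_m) (b : 'cV[R]_n) :
  sqn (col_mx a b) = sqn a + sqn b.
Proof. exact: dot_col_mx. Qed.

Lemma enorm_sqr n (u : 'cV[R]_n) : enorm u ^+ 2 = sqn u.
Proof. by rewrite sqr_sqrtr // sqn_ge0. Qed.

(** Expansion of [0 <= |2 e u - v|^2]. *)
Lemma young n (u v : 'cV[R]_n) (e : R) : 0 < e ->
  dot u v <= e * sqn u + (4 * e)^-1 * sqn v.
Proof.
move=> e0; have := sqn_ge0 ((2 * e) *: u - v).
rewrite sqnD sqnN sqnZ dotNr dotZl => h.
have e0' : 0 < (4 * e)^-1 by rewrite invr_gt0 mulr_gt0.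
have {h} := mulr_ge0 (ltW e0') h.
have -> : (4 * e)^-1 * ((2 * e) ^+ 2 * sqn u + 2 * - (2 * e * dot u v) + sqn v)
  = e * sqn u - dot u v + (4 * e)^-1 * sqn v.
  by field; rewrite gt_eqF.
lra.
Qed.

(** Cauchy-Schwarz on each row; the summand 1 only serves to make [C]
    positive when [M] is zero. *)
Lemma mulmx_bounded m n (M : 'M[R]_(m, n)) :
  exists2 C : R, 0 < C & forall u, sqn (M *m u) <= C * sqn u.
Proof.
exists (1 + \sum_i sqn (row i M)^T).
  by rewrite ltr_pwDl // sumr_ge0 // => i _; exact: sqn_ge0.
move=> u; rewrite mulrDl mulr_suml mul1r.
apply: ler_wpDl; first exact: sqn_ge0.
apply: ler_sum => i _; rewrite -expr2.
have -> : (M *m u) i 0 = dot (row i M)^T u.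
  by rewrite mxE; apply: eq_bigr => j _; rewrite !mxE.
have [s0|s0] := leP (sqn u) 0.
  by rewrite (sqn_eq0 s0) dot0r /sqn dot0r mulr0 expr0n.
have := sqn_ge0 (sqn u *: (row i M)^T - dot (row i M)^T u *: u).
rewrite sqnD sqnN !sqnZ dotNr dotZl dotZr.
set a := dot _ u; set s := sqn u; set t := sqn (row i M)^T => h.
have : 0 <= s * (t * s - a ^+ 2).
  by apply: le_trans h _; rewrite le_eqVlt; apply/orP; left; apply/eqP; ring.
by rewrite pmulr_rge0 // subr_ge0.
Qed.

End Dot.

(** * Smooth strongly convex functions *)

(** The two first-order inequalities through which [F] and [G] enter the proof.
    [g] plays the role of the gradient of [f], but differentiability is not
    recorded: in this form the class is visibly stable under block sums and
    under adding a convex quadratic, without computing any derivative.  Both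
    bounds use squared norms, so [c] is half the modulus of strong convexity and
    [L] the square of the Lipschitz constant. *)
Record smooth_sc {R : realType} {n : nat} (c L : R)
    (f : 'cV[R]_n -> R) (g : 'cV[R]_n -> 'cV[R]_n) : Prop := SmoothSC {
  sc_gt0 : 0 < c;
  lip_gt0 : 0 < L;
  sc_above : forall x y, f x + dot (g x) (y - x) + c * sqn (y - x) <= f y;
  sc_lip : forall x y, sqn (g x - g y) <= L * sqn (x - y)
}.

Section SmoothSC.
Local Open Scope classical_set_scope.
Context {R : realType}.

Lemma derive_dot_grad n (f : 'cV[R]_n -> R) x d :
  differentiable f x -> 'D_d f x = dot (grad f x) d.
Proof.
move=> df; rewrite deriveE //.
have {1}-> : d = \sum_(i < n) d i 0 *: delta_mx i 0.
  by rewrite [LHS]matrix_sum_delta; apply: eq_bigr => i _; rewrite big_ord1.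
rewrite linear_sum; apply: eq_bigr => i _.
by rewrite linearZ !mxE deriveE // mulrC.
Qed.

(** Let [t] tend to 0 from the right in the convexity inequality on the segment
    from [x] to [y]: its difference quotient tends to the directional
    derivative. *)
Lemma smooth_sc_grad n (f : 'cV[R]_n -> R) (mu L : R) : 0 < mu ->
  cont_differentiable f -> strongly_convex mu f -> lipschitz_grad L f ->
  smooth_sc (mu / 2) (1 + L ^+ 2) f (grad f).
Proof.
move=> mu0 [df _] fsc flip; split.
- by rewrite divr_gt0.
- by rewrite ltr_pwDl // sqr_ge0.
- move=> x y; rewrite -derive_dot_grad //; set d := y - x.
  set c := mu / 2 * sqn d.
  have quot_le : forall t : R, 0 < t -> t < 1 ->
      t^-1 * (f (t *: d + x) - f x) <= f y - f x - c + t * c.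
    move=> t t0 t1; rewrite ler_pdivrMl //.
    have /(fsc y x) : 0 <= t <= 1 by rewrite !ltW.
    rewrite enorm_sqr -/d scalerBl scale1r.
    have -> : t *: y + (x - t *: x) = t *: d + x.
      by rewrite /d scalerBr addrCA addrC.
    by rewrite /c; lra.
  have right_cvg :
      (fun t : R => t^-1 * (f (t *: d + x) - f x)) @ 0^'+ --> 'D_d f x.
    move=> U /(@diff_derivable _ _ _ f x d (df x)) /nbhs_ballP.
    move=> [_ /posnumP[e] xe_A].
    by exists e%:num => //= t xe_t /gt_eqF/negbT; apply: xe_A.
  suff : 'D_d f x <= f y - f x - c + 0 * c by rewrite /c; lra.
  have bound_cvg : (fun t : R => f y - f x - c + t * c) @ 0^'+ -->
      f y - f x - c + 0 * c.
    apply: cvgD; first exact: cvg_cst.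
    by apply: cvgMr_tmp; apply: cvg_at_right_filter.
  apply: (ler_cvg_to right_cvg bound_cvg).
  near=> t; apply: quot_le; near: t; [exact: nbhs_right_gt|exact: nbhs_right_lt].
- move=> x y; rewrite mulrDl mul1r -!enorm_sqr.
  apply: ler_wpDl; first exact: sqr_ge0.
  rewrite -exprMn ler_sqr ?nnegrE ?sqrtr_ge0 ?(le_trans _ (flip x y))
    ?sqrtr_ge0 //; exact: flip.
Unshelve. all: by end_near. Qed.

Lemma smooth_sc_block n p (c1 c2 L1 L2 : R) (f1 : 'cV[R]_n -> R) g1
    (f2 : 'cV[R]_p -> R) g2 :
  smooth_sc c1 L1 f1 g1 -> smooth_sc c2 L2 f2 g2 ->
  smooth_sc (Num.min c1 c2) (Num.max L1 L2)
    (fun u => f1 (usubmx u) + f2 (dsubmx u))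
    (fun u => col_mx (g1 (usubmx u)) (g2 (dsubmx u))).
Proof.
move=> [c1_gt0 L1_gt0 sc1 lip1] [c2_gt0 L2_gt0 sc2 lip2].
have splitB (x y : 'cV[R]_(n + p)) :
    x - y = col_mx (usubmx x - usubmx y) (dsubmx x - dsubmx y).
  by rewrite -{1}(vsubmxK x) -{1}(vsubmxK y) opp_col_mx add_col_mx.
have min1 : Num.min c1 c2 <= c1 by rewrite ge_min lexx.
have min2 : Num.min c1 c2 <= c2 by rewrite ge_min lexx orbT.
have max1 : L1 <= Num.max L1 L2 by rewrite le_max lexx.
have max2 : L2 <= Num.max L1 L2 by rewrite le_max lexx orbT.
split.
- by rewrite lt_min c1_gt0.
- by rewrite lt_max L1_gt0.
- move=> x y; rewrite splitB dot_col_mx sqn_col_mx.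
  have := sc1 (usubmx x) (usubmx y); have := sc2 (dsubmx x) (dsubmx y).
  have := ler_wpM2r (sqn_ge0 (usubmx y - usubmx x)) min1.
  have := ler_wpM2r (sqn_ge0 (dsubmx y - dsubmx x)) min2.
  lra.
- move=> x y; rewrite opp_col_mx add_col_mx splitB !sqn_col_mx.
  have := lip1 (usubmx x) (usubmx y); have := lip2 (dsubmx x) (dsubmx y).
  have := ler_wpM2r (sqn_ge0 (usubmx x - usubmx y)) max1.
  have := ler_wpM2r (sqn_ge0 (dsubmx x - dsubmx y)) max2.
  lra.
Qed.

Lemma smooth_sc_sq n (v : 'cV[R]_n) (beta : R) : 0 < beta ->
  smooth_sc (beta / 2) (beta ^+ 2) (fun r => beta / 2 * sqn (r - v))
    (fun r => beta *: (r - v)).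
Proof.
move=> beta0; split; [by rewrite divr_gt0|by rewrite exprn_gt0| |].
- move=> x y; rewrite dotZl -[y - v](subrK (x - v)) (sqnD (y - v - (x - v))).
  have -> : y - v - (x - v) = y - x by vec_ring.
  by rewrite (dotC (x - v)); lra.
- move=> x y; rewrite -scalerBr sqnZ.
  by have -> : x - v - (y - v) = x - y by vec_ring.
Qed.

(** The shape of the augmented Lagrangian in one of the blocks [x], [y], the
    other blocks being frozen in [s]. *)
Lemma smooth_sc_quad n m (c L : R) (f : 'cV[R]_n -> R) g (M : 'M[R]_(m, n))
    (lam s : 'cV[R]_m) (beta : R) :
  0 < beta -> smooth_sc c L f g ->
  exists L', smooth_sc c L'
    (fun x => f x - dot lam (M *m x + s) + beta / 2 * sqn (M *m x + s))
    (fun x => g x - M^T *m (lam - beta *: (M *m x + s))).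
Proof.
move=> beta0 [c0 L0 fsc flip].
have [C1 C10 hC1] := mulmx_bounded M; have [C2 C20 hC2] := mulmx_bounded M^T.
exists (2 * L + 2 * (C2 * (beta ^+ 2 * C1))); split => //.
- by rewrite addr_gt0 ?mulr_gt0 // exprn_gt0.
- move=> x y.
  have -> : M *m y + s = (M *m x + s) + M *m (y - x).
    by rewrite mulmxBr; vec_ring.
  rewrite (dotDl (g x)) dotNl [dot (M^T *m _) _]dotC -dot_mulmx.
  have := fsc x y; move: (M *m x + s) (M *m (y - x)) => r d.
  rewrite (sqnD r) (dotDr r) (dotDr lam) dotNr dotZr (dotC d lam) (dotC d r).
  have := mulr_ge0 (ltW beta0) (sqn_ge0 d); move: (dot (g x) _) => ?; lra.
- move=> x y.
  have -> : g x - M^T *m (lam - beta *: (M *m x + s)) -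
     (g y - M^T *m (lam - beta *: (M *m y + s))) =
     (g x - g y) + M^T *m (beta *: (M *m (x - y))).
    have -> : beta *: (M *m (x - y)) = (lam - beta *: (M *m y + s)) -
        (lam - beta *: (M *m x + s)).
      by rewrite mulmxBr; vec_ring.
    move: (lam - _ *: (M *m x + s)) (lam - _ *: (M *m y + s)) => a b.
    by rewrite mulmxBr; vec_ring.
  apply: le_trans (sqnD_le _ _) _.
  have := flip x y; have := hC2 (beta *: (M *m (x - y))).
  rewrite sqnZ.
  have := ler_wpM2l (ltW C20) (ler_wpM2l (sqr_ge0 beta) (hC1 (x - y))).
  lra.
Qed.

End SmoothSC.

(** * Minimisation over polyhedra *)

Section Minimisation.
Context {R : realType} {n : nat} {c L : R}.
Context {f : 'cV[R]_n -> R} {g : 'cV[R]_n -> 'cV[R]_n}.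
Hypothesis fg : smooth_sc c L f g.
Local Open Scope classical_set_scope.

(** Bound [f y] through the tangent at [y] and move its slope to [x]. *)
Lemma smooth_sc_descent x y :
  f y <= f x + dot (g x) (y - x) + (L + 1) * sqn (y - x).
Proof.
have := sc_above fg y x; have := sc_lip fg y x.
have := young (g y - g x) (y - x) (@ltr01 R).
have := sqn_ge0 (y - x).
rewrite -(opprB y x) sqnN dotNr dotDl dotNl.
have := mulr_ge0 (ltW (sc_gt0 fg)) (sqn_ge0 (y - x)).
move: (dot (g y) _) (dot (g x) _) => ? ?; lra.
Qed.

Lemma smooth_sc_monotone x y :
  2 * c * sqn (x - y) <= dot (g x - g y) (x - y).
Proof.
have := sc_above fg y x; have := sc_above fg x y.
rewrite -(opprB x y) sqnN dotNr dotDl dotNl.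
move: (dot (g y) _) (dot (g x) _) => ? ?; lra.
Qed.

(** First-order optimality in a feasible direction.  By the descent inequality
    a negative slope would be an actual decrease for small [t]. *)
Lemma min_segment_ge0 u d :
  (forall t, 0 < t -> t <= 1 -> f u <= f (u + t *: d)) -> 0 <= dot (g u) d.
Proof.
move=> umin; rewrite leNgt; apply/negP => neg.
set K := (L + 1) * sqn d.
have K0 : 0 <= K by rewrite mulr_ge0 ?sqn_ge0 // addr_ge0 // ltW // (lip_gt0 fg).
have tdom t : 0 < t -> t <= 1 -> - dot (g u) d <= t * K.
  move=> t0 t1; have := le_trans (umin t t0 t1) (smooth_sc_descent u _).
  have -> : u + t *: d - u = t *: d by vec_ring.
  rewrite dotZr sqnZ => h.
  have : 0 <= t * (dot (g u) d + t * K) by rewrite /K; lra.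
  rewrite pmulr_rge0 //; lra.
set a := - dot (g u) d in tdom; have a0 : 0 < a by rewrite oppr_gt0.
have K1 : 0 < a + 2 * K by lra.
(* Any [t <= 1] with [t * K < a] refutes [tdom]; this one also covers [K = 0]. *)
have := tdom (a / (a + 2 * K)); rewrite divr_gt0 // ler_pdivrMr // mul1r.
move=> /(_ isT); rewrite lerDl mulr_ge0 // => /(_ isT).
rewrite mulrAC ler_pdivlMr //; have := mulr_ge0 (ltW a0) K0.
have := mulr_gt0 a0 a0; lra.
Qed.

Lemma min_grad0 u : (forall v, f u <= f v) -> g u = 0.
Proof.
move=> umin; apply: sqn_eq0.
have : 0 <= dot (g u) (- g u) by apply: min_segment_ge0.
by rewrite dotNr /sqn; lra.
Qed.

Lemma grad0_min u v : g u = 0 -> f u <= f v.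
Proof.
move=> gu; have := sc_above fg u v.
by rewrite gu dot0l; have := mulr_ge0 (ltW (sc_gt0 fg)) (sqn_ge0 (v - u)); lra.
Qed.

Lemma continuous_dot {T : topologicalType} (u v : T -> 'cV[R]_n) :
  (forall i, continuous (fun t => u t i 0)) ->
  (forall i, continuous (fun t => v t i 0)) ->
  continuous (fun t => dot (u t) (v t)).
Proof.
move=> u_cts v_cts; apply: continuous_big => [|i _ t].
  exact: add_continuous.
by apply: cvgM; [exact: u_cts|exact: v_cts].
Qed.

Lemma continuous_tr_entry (x : 'cV[R]_n) i :
  continuous (fun v : 'rV[R]_n => (v^T - x) i 0).
Proof.
rewrite (_ : (fun v => _) = fun v : 'rV[R]_n => v 0 i - x i 0); last first.
  by apply/funext => v; rewrite !mxE.
move=> v; apply: (@cvgB _ _ _ (nbhs v) _ (fun w : 'rV[R]_n => w 0 i)).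
  exact: coord_continuous.
exact: cvg_cst.
Qed.

Lemma continuous_dot_tr (a x : 'cV[R]_n) :
  continuous (fun v : 'rV[R]_n => dot a (v^T - x)).
Proof.
apply: continuous_dot => i; first exact: cst_continuous.
exact: continuous_tr_entry.
Qed.

Lemma continuous_sqn_tr (x : 'cV[R]_n) :
  continuous (fun v : 'rV[R]_n => sqn (v^T - x)).
Proof. by apply: continuous_dot => i; exact: continuous_tr_entry. Qed.

(** Squeezed between its tangent and the descent parabola.  The transposition
    is there because compactness will be invoked for row vectors. *)
Lemma smooth_sc_continuous : continuous (fun v : 'rV[R]_n => f v^T).
Proof.
move=> v0; set x := v0^T.
pose lo v := f x + dot (g x) (v^T - x).
pose up v := f x + dot (g x) (v^T - x) + (L + 1) * sqn (v^T - x).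
have lo_cvg : lo v @[v --> nbhs v0] --> f x.
  have -> : f x = lo v0 by rewrite /lo -/x subrr dot0r addr0.
  apply: (@cvgD _ _ _ (nbhs v0)); first exact: cvg_cst.
  exact: continuous_dot_tr.
have up_cvg : up v @[v --> nbhs v0] --> f x.
  have -> : f x = up v0 by rewrite /up -/x subrr /sqn !dot0r mulr0 !addr0.
  apply: (@cvgD _ _ _ (nbhs v0) _ lo); last first.
    by apply: (@cvgMl_tmp _ _ (nbhs v0)); exact: continuous_sqn_tr.
  apply: (@cvgD _ _ _ (nbhs v0)); first exact: cvg_cst.
  exact: continuous_dot_tr.
apply: (@squeeze_cvgr _ (nbhs v0) _ _ lo up _ _ _ lo_cvg up_cvg); near=> v.
rewrite smooth_sc_descent andbT; apply: le_trans (sc_above fg x v^T).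
by rewrite lerDl mulr_ge0 ?sqn_ge0 // ltW // (sc_gt0 fg).
Unshelve. all: by end_near. Qed.

(** Strong convexity confines every point not worse than [p] to a ball around
    [p], and the feasible part of that ball is compact. *)
Lemma polyhedral_min m (K : 'M[R]_(m, n)) b p : nonneg_orthant (b - K *m p) ->
  exists2 u, nonneg_orthant (b - K *m u) &
    forall v, nonneg_orthant (b - K *m v) -> f u <= f v.
Proof.
move=> p_feas; set M := sqn (g p) / c ^+ 2.
pose S := [set v : 'rV[R]_n | nonneg_orthant (b - K *m v^T)] `&`
          [set v | sqn (v^T - p) <= M].
have c0 := sc_gt0 fg.
have pS : S p^T.
  split; rewrite /= trmxK // subrr /sqn dot0l.
  by rewrite divr_ge0 ?sqn_ge0 // sqr_ge0.
have slackE i (v : 'rV[R]_n) :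
    (b - K *m v^T) i 0 = b i 0 - dot (row i K)^T (v^T - 0).
  rewrite subr0 entry_addE entry_oppE mxE; congr (_ - _).
  by apply: eq_bigr => j _; rewrite !mxE.
have S_closed : closed S.
  apply: closedI; last first.
    apply: (preimage_closed _ (@closed_le _ M)) => v _.
    exact: continuous_sqn_tr.
  rewrite (_ : mkset _ = \bigcap_(i in [set: 'I_m])
    [set v : 'rV[R]_n | dot (row i K)^T (v^T - 0) <= b i 0]); last first.
    apply/seteqP; split => v /= v_feas i.
      by move=> _ /=; have := v_feas i; rewrite slackE subr_ge0.
    by rewrite slackE subr_ge0; exact: v_feas.
  apply: closed_bigI => i _.
  apply: (preimage_closed _ (@closed_le _ (b i 0))) => v _.
  exact: continuous_dot_tr.
have S_compact : compact S.
  apply: bounded_closed_compact => //.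
  exists (Num.sqrt M + `|p^T|); split; first exact: num_real.
  move=> B /ltW MB v [_ /= vM]; apply: le_trans MB.
  rewrite -(subrK p^T v); apply: le_trans (ler_normD _ _) _; rewrite lerD2r.
  rewrite [leLHS]/Num.norm /= mx_normrE; apply/bigmax_leP; split.
    exact: sqrtr_ge0.
  move=> -[i j] _ /=; rewrite -sqrtr_sqr ler_wsqrtr //; apply: le_trans vM.
  rewrite ord1 /sqn /dot (bigD1 j) //= !mxE -expr2 lerDl.
  by apply: sumr_ge0 => k _; rewrite -expr2 sqr_ge0.
have cont : {within S, continuous (fun v : 'rV[R]_n => f v^T)}.
  by apply: continuous_subspaceT; exact: smooth_sc_continuous.
have [u /set_mem[u_feas _] umin] :=
  EVT_min_rV (ex_intro _ _ pS : S !=set0) S_compact cont.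
exists u^T => // v v_feas.
have [vM|vM] := leP (sqn (v - p)) M.
  by have := umin v^T; rewrite trmxK; apply; apply/mem_set; split;
    rewrite /= trmxK.
apply: le_trans (umin p^T (mem_set pS)) _; rewrite trmxK.
have := sc_above fg p v; have c20 : 0 < c / 2 by rewrite divr_gt0.
have := young (v - p) (- g p) c20.
rewrite sqnN dotNr (dotC (v - p)).
have -> : (4 * (c / 2))^-1 * sqn (g p) = c / 2 * M.
  by rewrite /M; field; rewrite gt_eqF.
have := ler_wpM2l (ltW c20) (ltW vM); lra.
Qed.

(** Full row rank replaces a theorem of the alternative.  The slack is unchanged
    along the kernel of [K], so the gradient at the minimiser is orthogonal to
    that kernel and equals [K^T lam] with [lam := S^T (g u)]; conversely [S]
    lifts any change of the slack to a feasible direction, which gives the sign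
    condition on [lam]. *)
Lemma polyhedral_kkt m (K : 'M[R]_(m, n)) (S : 'M[R]_(n, m)) b :
  K *m S = 1%:M ->
  exists u lam, [/\ g u = K^T *m lam, nonneg_orthant (b - K *m u) &
    forall z, nonneg_orthant z -> dot lam (z - (b - K *m u)) <= 0].
Proof.
move=> KS.
have KSv v : K *m (S *m v) = v by rewrite mulmxA KS mul1mx.
have [|u u_feas umin] := @polyhedral_min m K b (S *m b).
  by rewrite KSv subrr => i; rewrite mxE.
exists u, (S^T *m g u); split => //.
- have kerK d : K *m d = 0 -> 0 <= dot (g u) d.
    move=> Kd; apply: min_segment_ge0 => t _ _; apply: umin.
    by rewrite mulmxDr -scalemxAr Kd scaler0 addr0.
  have orth h : dot (g u) (h - S *m (K *m h)) = 0.
    have Kd : K *m (h - S *m (K *m h)) = 0 by rewrite mulmxBr KSv subrr.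
    apply/eqP; rewrite eq_le kerK // andbT -oppr_ge0 -dotNr.
    by apply: kerK; rewrite mulmxN Kd oppr0.
  apply/eqP; rewrite -subr_eq0; apply/eqP/sqn_eq0.
  have orthK h : dot (g u - K^T *m (S^T *m g u)) h = 0.
    rewrite dotDl dotNl (dotC (K^T *m _)) -!dot_mulmx (dotC (S *m _)).
    by rewrite -dotNr -dotDr orth.
  by rewrite /sqn orthK.
- move=> z z_ge0; rewrite dotC -dot_mulmx dotC.
  rewrite -oppr_ge0 -dotNr -mulmxN; apply: min_segment_ge0 => t t0 t1.
  apply: umin; rewrite mulmxDr -scalemxAr KSv.
  have -> : b - (K *m u + t *: - (z - (b - K *m u))) =
      (1 - t) *: (b - K *m u) + t *: z by vec_ring.
  move=> i; rewrite !entryE.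
  apply: addr_ge0; apply: mulr_ge0 => //; [by rewrite subr_ge0| |exact: ltW].
  by have := u_feas i; rewrite !entryE.
Qed.

(** A constrained minimiser is characterised by its variational inequality. *)
Lemma orthant_minP z : nonneg_orthant z ->
  (forall z', nonneg_orthant z' -> f z <= f z') <->
  normal_cone nonneg_orthant z (- g z).
Proof.
move=> z_ge0; split => [zmin|[_ zmin] z' /zmin].
  split => // z' z'_ge0; rewrite dotNl oppr_le0.
  apply: min_segment_ge0 => t t0 t1; apply: zmin.
  have -> : z + t *: (z' - z) = (1 - t) *: z + t *: z' by vec_ring.
  move=> i; rewrite !entryE.
  by apply: addr_ge0; apply: mulr_ge0; rewrite ?subr_ge0 // ltW.
rewrite dotNl; have := sc_above fg z z'.
by have := mulr_ge0 (ltW (sc_gt0 fg)) (sqn_ge0 (z' - z)); lra.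
Qed.

End Minimisation.

(** * The augmented Lagrangian and its inner solutions *)

Section Lagrangian.
Context {R : realType} {nx ny m : nat}.
Context {F : 'cV[R]_nx -> R} {G : 'cV[R]_ny -> R}.
Context {gF : 'cV[R]_nx -> 'cV[R]_nx} {gG : 'cV[R]_ny -> 'cV[R]_ny}.
Context {cF cG LF LG : R}.
Hypothesis scF : smooth_sc cF LF F gF.
Hypothesis scG : smooth_sc cG LG G gG.
Context {A : 'M[R]_(m, nx)} {B : 'M[R]_(m, ny)} (b : 'cV[R]_m).
Context {beta : R}.
Hypothesis beta_gt0 : 0 < beta.
Notation point := (pd_point R nx ny m).
Implicit Types w v : point.

Definition resid w := residual A B b (px w) (py w) (pz w).

Definition lagr (lam : 'cV[R]_m) w : R :=
  F (px w) + G (py w) - dot lam (resid w) + beta / 2 * sqn (resid w).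

(** The KKT conditions without primal feasibility.  A critical [w] is a KKT point
    of the problem in which [b] is replaced by [b + resid w]. *)
Definition critical w : Prop :=
  [/\ gF (px w) = A^T *m plam w, gG (py w) = B^T *m plam w
    & normal_cone nonneg_orthant (pz w) (plam w)].

(** Optimality conditions of [lagr lam] over [z >= 0].  The component [plam w]
    holds the updated multiplier [lam - beta *: resid w], which makes inner
    solutions critical points, to be compared with the KKT point. *)
Definition inner_sol (lam : 'cV[R]_m) w : Prop :=
  critical w /\ plam w = lam - beta *: resid w.

Lemma residB w v : resid v - resid w =
  A *m (px v - px w) + B *m (py v - py w) + (pz v - pz w).
Proof. by rewrite /resid /residual !mulmxBr; vec_ring. Qed.

(** The quadratic penalty is expanded exactly, hence the gain
    [beta / 2 * sqn (resid v - resid w)] next to the strong convexity gains. *)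
Lemma lagr_growth lam mu w v : mu = lam - beta *: resid w ->
  lagr lam w + dot (gF (px w) - A^T *m mu) (px v - px w)
  + dot (gG (py w) - B^T *m mu) (py v - py w) - dot mu (pz v - pz w)
  + cF * sqn (px v - px w) + cG * sqn (py v - py w)
  + beta / 2 * sqn (resid v - resid w) <= lagr lam v.
Proof.
move=> muE; rewrite (dotDl (gF _)) (dotDl (gG _)) !dotNl.
rewrite (dotC (A^T *m _)) (dotC (B^T *m _)) -!dot_mulmx.
have := sc_above scF (px w) (px v); have := sc_above scG (py w) (py v).
have : dot mu (resid v - resid w) = dot (A *m (px v - px w)) mu +
    dot (B *m (py v - py w)) mu + dot mu (pz v - pz w).
  by rewrite residB !(dotDr _ _ mu) !(dotC mu (_ *m _)).
rewrite /lagr -[resid v](subrK (resid w)) addrK.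
move: (resid v - resid w) => d; move: (dot (A *m _) mu) (dot (B *m _) mu) => ? ?.
rewrite (addrC d) (sqnD _ d) (dotDr _ d) muE (dotDl lam) dotNl dotZl.
move: (dot (gF _) _) (dot (gG _) _) (dot _ (pz v - pz w)) => ? ? ?; lra.
Qed.

Lemma lagr_feasible lam w : resid w = 0 -> lagr lam w = F (px w) + G (py w).
Proof. by move=> rw; rewrite /lagr rw /sqn !dot0r mulr0 subr0 addr0. Qed.

Lemma inner_sol_min lam w v : inner_sol lam w -> nonneg_orthant (pz v) ->
  lagr lam w + cF * sqn (px v - px w) + cG * sqn (py v - py w)
  + beta / 2 * sqn (resid v - resid w) <= lagr lam v.
Proof.
move=> [[xw yw [_ zw]] lamw] v_ge0; have := lagr_growth v lamw.
rewrite xw yw !subrr !dot0l; have := zw _ v_ge0; lra.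
Qed.

Lemma inner_sol_resid lam w v : inner_sol lam w -> nonneg_orthant (pz v) ->
  lagr lam w + beta / 2 * sqn (resid v - resid w) <= lagr lam v.
Proof.
move=> solw v_ge0; have := inner_sol_min solw v_ge0.
have := mulr_ge0 (ltW (sc_gt0 scF)) (sqn_ge0 (px v - px w)).
have := mulr_ge0 (ltW (sc_gt0 scG)) (sqn_ge0 (py v - py w)); lra.
Qed.

Lemma inner_sol_le lam w v : inner_sol lam w -> nonneg_orthant (pz v) ->
  lagr lam w <= lagr lam v.
Proof.
move=> solw v_ge0; apply: le_trans (inner_sol_resid solw v_ge0).
by rewrite lerDl mulr_ge0 ?sqn_ge0 // ltW // divr_gt0.
Qed.

(** Strong monotonicity of the gradients, with the monotonicity of the normal
    cone absorbing the slack variables. *)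
Lemma critical_monotone w v : critical w -> critical v ->
  2 * cF * sqn (px w - px v) + 2 * cG * sqn (py w - py v)
  <= dot (plam w - plam v) (resid w - resid v).
Proof.
move=> [xw yw [w_ge0 zw]] [xv yv [v_ge0 zv]].
have := smooth_sc_monotone scF (px w) (px v).
have := smooth_sc_monotone scG (py w) (py v).
rewrite xw yw xv yv -!mulmxBr.
rewrite (dotC (A^T *m _)) (dotC (B^T *m _)) -!dot_mulmx.
have -> : dot (plam w - plam v) (resid w - resid v) =
    dot (A *m (px w - px v)) (plam w - plam v) +
    dot (B *m (py w - py v)) (plam w - plam v) +
    dot (plam w - plam v) (pz w - pz v).
  by rewrite residB !(dotDr _ _ (_ - _)) !(dotC (_ *m _)).
have := zw _ v_ge0; have := zv _ w_ge0.
rewrite -(opprB (pz w)) dotNr (dotDl (plam w) _ (pz w - _)) dotNl.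
move: (dot (A *m _) _) (dot (B *m _) _) => ? ?.
move: (dot _ _) (dot _ _) => ? ?; lra.
Qed.

Lemma aug_lagrangianE x y z lam : nonneg_orthant z ->
  aug_lagrangian F G A B b beta x y z lam =
  (lagr lam (PDPoint x y z lam))%:E.
Proof.
move=> z_ge0; rewrite /aug_lagrangian /indicator mem_set // adde0.
by rewrite enorm_sqr.
Qed.

(** This is what keeps the [z] iterates in the orthant. *)
Lemma aug_lagrangian_infeasible x y z lam : ~ nonneg_orthant z ->
  aug_lagrangian F G A B b beta x y z lam = +oo%E.
Proof.
by move=> z_neg; rewrite /aug_lagrangian /indicator memNset.
Qed.

Lemma argmin_x lam x0 y z : nonneg_orthant z ->
  argmin (fun x => aug_lagrangian F G A B b beta x y z lam) x0 <->
  gF x0 = A^T *m (lam - beta *: residual A B b x0 y z).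
Proof.
move=> z_ge0.
set s := B *m y + z - b; have [L' sc'] := smooth_sc_quad A lam s beta_gt0 scF.
have resE x : residual A B b x y z = A *m x + s.
  by rewrite /residual /s; vec_ring.
have lagrE x : aug_lagrangian F G A B b beta x y z lam =
    (G y + (F x - dot lam (A *m x + s)
      + beta / 2 * sqn (A *m x + s)))%:E.
  by rewrite aug_lagrangianE // /lagr /resid /= resE; congr EFin; ring.
rewrite resE; split => [h|/eqP].
  apply/eqP; rewrite -subr_eq0; apply/eqP/(min_grad0 sc') => u.
  by have := h u; rewrite !lagrE lee_fin lerD2l.
rewrite -subr_eq0 => /eqP g0 u; rewrite !lagrE lee_fin lerD2l.
exact: (grad0_min sc' u g0).
Qed.

Lemma argmin_y lam x y0 z : nonneg_orthant z ->
  argmin (fun y => aug_lagrangian F G A B b beta x y z lam) y0 <->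
  gG y0 = B^T *m (lam - beta *: residual A B b x y0 z).
Proof.
move=> z_ge0.
set s := A *m x + z - b; have [L' sc'] := smooth_sc_quad B lam s beta_gt0 scG.
have resE y : residual A B b x y z = B *m y + s.
  by rewrite /residual /s; vec_ring.
have lagrE y : aug_lagrangian F G A B b beta x y z lam =
    (F x + (G y - dot lam (B *m y + s)
      + beta / 2 * sqn (B *m y + s)))%:E.
  by rewrite aug_lagrangianE // /lagr /resid /= resE; congr EFin; ring.
rewrite resE; split => [h|/eqP].
  apply/eqP; rewrite -subr_eq0; apply/eqP/(min_grad0 sc') => u.
  by have := h u; rewrite !lagrE lee_fin lerD2l.
rewrite -subr_eq0 => /eqP g0 u; rewrite !lagrE lee_fin lerD2l.
exact: (grad0_min sc' u g0).
Qed.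

Lemma argmin_z lam x y z0 :
  argmin (fun z => aug_lagrangian F G A B b beta x y z lam) z0 <->
  normal_cone nonneg_orthant z0 (lam - beta *: residual A B b x y z0).
Proof.
set s := A *m x + B *m y - b; set t := beta^-1 *: lam - s.
have sc' := smooth_sc_sq t beta_gt0.
have beta_neq0 : beta != 0 by rewrite gt_eqF.
(* Completing the square: [t] is the unconstrained minimiser in [z]. *)
have lagrE z : lagr lam (PDPoint x y z lam) =
    F x + G y - (2 * beta)^-1 * sqn lam + beta / 2 * sqn (z - t).
  have -> : z - t = residual A B b x y z - beta^-1 *: lam.
    by rewrite /residual /t /s; vec_ring.
  rewrite /lagr /resid /= sqnD sqnN sqnZ dotNr dotZr (dotC lam).
  by field.
have gradE : lam - beta *: residual A B b x y z0 = - (beta *: (z0 - t)).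
  have -> : lam = beta *: (beta^-1 *: lam) by rewrite scalerA mulfV ?scale1r.
  by rewrite /t /s /residual; vec_ring.
have argmin_ge0 : argmin (fun z => aug_lagrangian F G A B b beta x y z lam) z0
    -> nonneg_orthant z0.
  move=> h; apply: contrapT => z0_neg.
  have := h 0; rewrite (aug_lagrangian_infeasible _ _ _ z0_neg).
  by rewrite aug_lagrangianE ?leye_eq // => i; rewrite mxE.
rewrite gradE; split => [h|h].
  have z0_ge0 := argmin_ge0 h; apply/(orthant_minP sc' z0_ge0) => z z_ge0.
  have := h z; rewrite !aug_lagrangianE // lee_fin !lagrE; lra.
have z0_ge0 : nonneg_orthant z0 by case: h.
move=> z; have [z_ge0|z_neg] := pselect (nonneg_orthant z); last first.
  by rewrite (aug_lagrangian_infeasible _ _ _ z_neg) leey.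
rewrite !aug_lagrangianE // lee_fin !lagrE.
by have /(orthant_minP sc' z0_ge0)/(_ z z_ge0) := h; lra.
Qed.

(** Optimality conditions of the successive [x], [y] and [z] updates at [lam]. *)
Definition sweep lam w w' : Prop :=
  [/\ gF (px w') = A^T *m (lam - beta *: residual A B b (px w') (py w) (pz w)),
      gG (py w') = B^T *m (lam - beta *: residual A B b (px w') (py w') (pz w))
    & normal_cone nonneg_orthant (pz w') (lam - beta *: resid w')].

(** Feasibility of the previous [z] is essential: otherwise the [x] and [y]
    subproblems have the constant value [+oo] and every point solves them. *)
Lemma admm_stepE tau w w' : nonneg_orthant (pz w) ->
  admm_step F G A B b beta tau w w' <->
  sweep (plam w) w w' /\ plam w' = plam w - tau *: resid w'.
Proof.
move=> w_ge0; split.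
  by case=> /(argmin_x _ _ _ w_ge0) hx /(argmin_y _ _ _ w_ge0) hy /argmin_z hz.
case=> -[hx hy hz] hl.
by split => //; [apply/argmin_x|apply/argmin_y|apply/argmin_z].
Qed.

(** A minimiser over the polyhedron that has no constraints. *)
Lemma smooth_sc_stationary n c L (f : 'cV[R]_n -> R) g :
  smooth_sc c L f g -> exists u, g u = 0.
Proof.
move=> fg; have K1 : (0 : 'M[R]_(0, n)) *m 0 = 1%:M.
  by rewrite [RHS]flatmx0 mul0mx.
have [u [lam [gu _ _]]] := polyhedral_kkt fg 0 K1.
by exists u; rewrite gu trmx0 mul0mx.
Qed.

Lemma sweep_exists lam mu w : exists w', sweep lam w w' /\
  plam w' = lam - mu *: resid w'.
Proof.
have [Lx scx] := smooth_sc_quad A lam (B *m py w + pz w - b) beta_gt0 scF.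
have [x /eqP] := smooth_sc_stationary scx; rewrite subr_eq0 => /eqP gx.
have [Ly scy] := smooth_sc_quad B lam (A *m x + pz w - b) beta_gt0 scG.
have [y /eqP] := smooth_sc_stationary scy; rewrite subr_eq0 => /eqP gy.
set s := A *m x + B *m y - b; set t := beta^-1 *: lam - s.
have KS : (- 1%:M : 'M[R]_m) *m (- 1%:M) = 1%:M.
  by rewrite mulNmx mulmxN mulmx1 opprK.
have [z [nu []]] := polyhedral_kkt (smooth_sc_sq t beta_gt0) 0 KS.
rewrite linearN /= trmx1 !mulNmx !mul1mx sub0r opprK => gz z_ge0 znu.
exists (PDPoint x y z (lam - mu *: residual A B b x y z)); split => //=.
split => /=.
- rewrite gx; congr (_ *m (_ - _ *: _)).
  by rewrite /residual; vec_ring.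
- rewrite gy; congr (_ *m (_ - _ *: _)).
  by rewrite /residual; vec_ring.
- set w' := PDPoint _ _ _ _.
  have -> : lam - beta *: resid w' = nu.
    have -> : nu = - (beta *: (z - t)) by rewrite gz opprK.
    have {1}-> : lam = beta *: (beta^-1 *: lam).
      by rewrite scalerA mulfV ?scale1r ?gt_eqF.
    by rewrite /w' /resid /residual /t /s /=; vec_ring.
  by [].
Qed.

(** Add the growth inequalities at the three block minimisers.  The gain of the
    [x] block is dropped: [x] is updated first, so no block gradient at [w']
    depends on the old [x]. *)
Lemma sweep_descent lam w w' : nonneg_orthant (pz w) -> sweep lam w w' ->
  lagr lam w' + cG * sqn (py w - py w') + beta / 2 * sqn (pz w - pz w')
  <= lagr lam w.
Proof.
case: w w' => x y z l [x' y' z' l'] /= z_ge0 [/= xw yw [_ zw]].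
pose w1 := PDPoint x' y z l; pose w2 := PDPoint x' y' z l.
set w := PDPoint x y z l; set w' := PDPoint x' y' z' l' in zw *.
have x_growth := @lagr_growth lam _ w1 w erefl.
have y_growth := @lagr_growth lam _ w2 w1 erefl.
have z_growth := @lagr_growth lam _ w' w2 erefl.
rewrite /= xw subrr dot0l subrr dot0r subrr dot0r sqn0 in x_growth.
rewrite /= yw !subrr !dot0r dot0l sqn0 in y_growth.
rewrite residB /= !subrr !dot0r !mulmx0 !add0r !sqn0 in z_growth.
have := zw _ z_ge0.
have := mulr_ge0 (ltW beta_gt0) (sqn_ge0 (resid w1 - resid w2)).
have := mulr_ge0 (ltW beta_gt0) (sqn_ge0 (resid w - resid w1)).
have := mulr_ge0 (ltW (sc_gt0 scF)) (sqn_ge0 (x - x')).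
move: (dot _ (z - z')) z_growth => ? ?; lra.
Qed.

(** The block gradients at [w'] vanish up to the part of the residual that was
    updated later: [e1] for the [x] block, [e2] for the [y] block, nothing for
    the [z] block.  Strong convexity therefore bounds the remaining gap by
    |e1|^2 + |e2|^2, and [sweep_descent] bounds that by the decrease. *)
Lemma sweep_cost_to_go : exists2 kappa, 0 < kappa & forall lam w w' v,
  nonneg_orthant (pz w) -> sweep lam w w' -> nonneg_orthant (pz v) ->
  lagr lam w' - lagr lam v <= kappa * (lagr lam w - lagr lam w').
Proof.
have cF0 := sc_gt0 scF; have cG0 := sc_gt0 scG.
have [a a0 ha] := mulmx_bounded A^T; have [c c0 hc] := mulmx_bounded B^T.
have [d d0 hd] := mulmx_bounded B.
set p := (4 * cF)^-1 * (beta ^+ 2 * a); set q := (4 * cG)^-1 * (beta ^+ 2 * c).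
have p0 : 0 < p by positivity.
have q0 : 0 < q by positivity.
set kappa := 2 * p * d / cG + 2 * (2 * p + q) / beta.
have kappa0 : 0 < kappa.
  by positivity.
exists kappa => // lam w w' v w_ge0 sw v_ge0.
have desc := sweep_descent w_ge0 sw.
suff : lagr lam w' - lagr lam v <=
    kappa * (cG * sqn (py w - py w') + beta / 2 * sqn (pz w - pz w')).
  by move/le_trans; apply; rewrite ler_pM2l //; lra.
case: sw => xw yw [_ zw]; have := zw _ v_ge0.
have := @lagr_growth lam _ w' v erefl; rewrite xw yw -!mulmxBr.
set e1 := lam - _ - _; set e2 := lam - _ - _.
have e1E : e1 = beta *: (B *m (py w' - py w) + (pz w' - pz w)).
  by rewrite /e1 /resid /residual mulmxBr; vec_ring.
have e2E : e2 = beta *: (pz w' - pz w) by rewrite /e2 /resid /residual; vec_ring.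
have := young (- (px v - px w')) (A^T *m e1) cF0.
have := young (- (py v - py w')) (B^T *m e2) cG0.
rewrite !sqnN !dotNl !(dotC (_ - _) (_ *m _)).
have e1_le : sqn (A^T *m e1) <= beta ^+ 2 * a *
   (2 * d * sqn (py w - py w') + 2 * sqn (pz w - pz w')).
  apply: le_trans (ha _) _; rewrite e1E sqnZ (sqnBC (py w)) (sqnBC (pz w)).
  rewrite [leLHS]mulrCA mulrA ler_pM2l ?mulr_gt0 ?exprn_gt0 //.
  have := sqnD_le (B *m (py w' - py w)) (pz w' - pz w).
  have := hd (py w' - py w); lra.
have e2_le : sqn (B^T *m e2) <= beta ^+ 2 * c * sqn (pz w - pz w').
  by apply: le_trans (hc _) _; rewrite e2E sqnZ (sqnBC (pz w)) mulrCA mulrA.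
have cF4 : 0 < (4 * cF)^-1 by rewrite invr_gt0 mulr_gt0.
have cG4 : 0 < (4 * cG)^-1 by rewrite invr_gt0 mulr_gt0.
have := ler_wpM2l (ltW cF4) e1_le; have := ler_wpM2l (ltW cG4) e2_le.
rewrite [leRHS]mulrA -/q; move=> e2_le'; rewrite [leRHS]mulrA -/p; move: e2_le'.
have := mulr_ge0 (ltW beta_gt0) (sqn_ge0 (resid v - resid w')).
have -> : kappa * (cG * sqn (py w - py w') + beta / 2 * sqn (pz w - pz w')) =
    p * (2 * d * sqn (py w - py w') + 2 * sqn (pz w - pz w'))
    + q * sqn (pz w - pz w')
    + (2 * p * d / cG * (beta / 2) * sqn (pz w - pz w')
       + 2 * (2 * p + q) / beta * cG * sqn (py w - py w')).
  by rewrite /kappa; field; rewrite !gt_eqF.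
have : 0 <= 2 * p * d / cG * (beta / 2) * sqn (pz w - pz w').
  by rewrite mulr_ge0 ?sqn_ge0 // ltW //; positivity.
have : 0 <= 2 * (2 * p + q) / beta * cG * sqn (py w - py w').
  by rewrite mulr_ge0 ?sqn_ge0 // ltW //; positivity.
move: (dot (A^T *m _) _) (dot (B^T *m _) _) (dot _ (pz v - _)) => ? ? ?; lra.
Qed.

(** [lagr lam' w'] and [lagr lam w'] differ by a term linear in [resid w'];
    replacing it by [resid w] costs what the residual term of the growth around
    [w] pays for. *)
Lemma dual_ascent lam lam' w w' : inner_sol lam w -> inner_sol lam' w' ->
  lagr lam w + dot (lam - lam') (resid w) - (2 * beta)^-1 * sqn (lam - lam')
  <= lagr lam' w'.
Proof.
move=> solw [[_ _ [w'_ge0 _]] _].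
have := inner_sol_resid solw w'_ge0.
have -> : lagr lam' w' = lagr lam w' + dot (lam - lam') (resid w').
  by rewrite /lagr dotDl dotNl; ring.
have b2 : 0 < beta / 2 by rewrite divr_gt0.
have := young (resid w' - resid w) (- (lam - lam')) b2.
have -> : (4 * (beta / 2))^-1 = (2 * beta)^-1 :> R.
  by field; rewrite gt_eqF.
rewrite sqnN dotNr (dotC (resid w' - _)) dotDr dotNr.
move: (dot _ (resid w')) (dot _ (resid w)) => ? ?; lra.
Qed.

Section FullRank.
Hypothesis AB_full : row_free (row_mx A B).

Lemma right_inverse : exists S : 'M[R]_(nx + ny, m), row_mx A B *m S = 1%:M.
Proof. by have /row_freeP := AB_full. Qed.

(** The transpose of a right inverse of [A B] recovers [lam] from [A^T lam] and
    [B^T lam]. *)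
Lemma dual_coercive : exists2 C, 0 < C & forall lam : 'cV[R]_m,
  sqn lam <= C * (sqn (A^T *m lam) + sqn (B^T *m lam)).
Proof.
have [S KS] := right_inverse; have [C C0 hC] := mulmx_bounded S^T.
exists C => // lam; rewrite -sqn_col_mx -mul_col_mx -tr_row_mx.
by apply: le_trans (hC _); rewrite mulmxA -trmx_mul KS trmx1 mul1mx.
Qed.

(** By [critical_monotone] the primal distance is controlled by <dlam, dr>; the
    Lipschitz gradients turn it into a bound on [A^T dlam] and [B^T dlam], and
    [dual_coercive] into one on [dlam]. *)
Lemma multiplier_lipschitz : exists2 C, 0 < C & forall w v,
  critical w -> critical v ->
  sqn (plam w - plam v) <= C * sqn (resid w - resid v).
Proof.
have [C0 C00 hC0] := dual_coercive.
have LF0 := lip_gt0 scF; have LG0 := lip_gt0 scG.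
have cF0 := sc_gt0 scF; have cG0 := sc_gt0 scG.
set C := C0 * (LF / (2 * cF) + LG / (2 * cG)).
have C_gt0 : 0 < C by rewrite mulr_gt0 // addr_gt0 // divr_gt0 // mulr_gt0.
exists (C ^+ 2); first by rewrite exprn_gt0.
move=> w v cw cv; have := critical_monotone cw cv.
case: cw cv => [xw yw _] [xv yv _].
have := hC0 (plam w - plam v); rewrite !mulmxBr -xw -xv -yw -yv.
have := sc_lip scF (px w) (px v); have := sc_lip scG (py w) (py v).
set dx := sqn (px w - px v); set dy := sqn (py w - py v).
have dx0 : 0 <= dx by exact: sqn_ge0.
have dy0 : 0 <= dy by exact: sqn_ge0.
have C20 : 0 < (2 * C)^-1 by rewrite invr_gt0 mulr_gt0.
have := young (plam w - plam v) (resid w - resid v) C20.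
move: (sqn (gF _ - _)) (sqn (gG _ - _)) (dot _ _) => gx gy p.
move: (sqn (plam w - _)) (sqn (resid w - _)) => l r hy hG hF hl hp.
have dxp : dx <= p / (2 * cF).
  by rewrite ler_pdivlMr ?mulr_gt0 //; have := mulr_ge0 (ltW cG0) dy0; lra.
have dyp : dy <= p / (2 * cG).
  by rewrite ler_pdivlMr ?mulr_gt0 //; have := mulr_ge0 (ltW cF0) dx0; lra.
have lp : l <= C * p.
  apply: le_trans hl _; rewrite -mulrA ler_pM2l //.
  have := ler_wpM2l (ltW LF0) dxp; have := ler_wpM2l (ltW LG0) dyp.
  lra.
have := ler_wpM2l (ltW C_gt0) hy.
have -> : C * ((2 * C)^-1 * l + (4 * (2 * C)^-1)^-1 * r) =
    l / 2 + C ^+ 2 * r / 2.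
  by field; rewrite gt_eqF.
lra.
Qed.

(** Quadratic growth of the augmented Lagrangian at the KKT multiplier bounds
    the gap by <plam w - plam v, resid w> plus a multiple of |resid w|^2, and
    the multipliers are Lipschitz in the residual.  In other words [d] satisfies
    a Polyak-Lojasiewicz inequality. *)
Lemma dual_gap_upper : exists2 C, 0 < C & forall lam w v,
  inner_sol lam w -> critical v -> resid v = 0 ->
  lagr lam v - lagr lam w <= C * sqn (resid w).
Proof.
have [C C0 hC] := multiplier_lipschitz.
exists (C + 1 + beta); first by rewrite !addr_gt0.
move=> lam w v [cw lamw] cv rv0.
have v_sol : inner_sol (plam v) v by split; rewrite // rv0 scaler0 subr0.
have w_ge0 : nonneg_orthant (pz w) by case: cw => _ _ [].
have := inner_sol_min v_sol w_ge0.
have := hC _ _ cw cv; have := young (plam w - plam v) (resid w) (@ltr01 R).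
have lamE : lam = plam w + beta *: resid w by rewrite lamw subrK.
rewrite !(lagr_feasible _ rv0) rv0 subr0 /lagr lamE.
rewrite (dotDl _ (beta *: _)) (dotDl (plam w)) dotNl dotZl -/(sqn (resid w)).
have := mulr_ge0 (ltW (sc_gt0 scF)) (sqn_ge0 (px w - px v)).
have := mulr_ge0 (ltW (sc_gt0 scG)) (sqn_ge0 (py w - py v)).
have := mulr_ge0 (ltW beta_gt0) (sqn_ge0 (resid w)).
have := sqn_ge0 (resid w).
move: (dot (plam w) (resid w)) (dot (plam v) (resid w)) => ? ?. lra.
Qed.

Lemma kkt_exists : exists w, critical w /\ resid w = 0.
Proof.
have [S KS] := right_inverse.
have [u [lam [gu u_ge0 ulam]]] :=
  polyhedral_kkt (smooth_sc_block scF scG) b KS.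
rewrite tr_row_mx mul_col_mx in gu; have [gFu gGu] := eq_col_mx gu.
exists (PDPoint (usubmx u) (dsubmx u) (b - row_mx A B *m u) lam).
split; first by split.
have uE : row_mx A B *m u = A *m usubmx u + B *m dsubmx u.
  by rewrite -{1}[u]vsubmxK mul_row_col.
by rewrite /resid /residual /= uE; vec_ring.
Qed.

(** With the residual [r] as a third block, the inner problem is the minimisation
    of [F x + G y + beta/2 |r - lam/beta|^2] subject to [A x + B y - r <= b]. *)
Lemma inner_sol_exists lam : exists w, inner_sol lam w.
Proof.
have [S KS] := right_inverse.
have KS' : row_mx (row_mx A B) (-1%:M) *m col_mx S 0 = 1%:M :> 'M[R]_m.
  by rewrite mul_row_col KS mulmx0 addr0.
have [u [mu [gu u_ge0 umu]]] := polyhedral_kkt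
  (smooth_sc_block (smooth_sc_block scF scG)
     (smooth_sc_sq (beta^-1 *: lam) beta_gt0)) b KS'.
rewrite !tr_row_mx !mul_col_mx in gu.
have [guxy gur] := eq_col_mx gu; have [gFu gGu] := eq_col_mx guxy.
set x := usubmx (usubmx u) in gFu; set y := dsubmx (usubmx u) in gGu.
set r := dsubmx u in gur; set z := b - _ in u_ge0 umu.
have zE : z = b - (A *m x + B *m y - r).
  rewrite /z -[in LHS](vsubmxK u) -(vsubmxK (usubmx u)) !mul_row_col.
  by rewrite mulNmx mul1mx.
exists (PDPoint x y z mu); split; first by split.
have -> : resid (PDPoint x y z mu) = r.
  by rewrite /resid /residual /= zE; vec_ring.
move: gur; rewrite /= linearN /= trmx1 mulNmx mul1mx scalerBr scalerA.
rewrite mulfV ?gt_eqF // scale1r => /(congr1 -%R).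
by rewrite opprK opprB => <-.
Qed.

(** Primal gap of [w] plus dual gap of [plam w], where [v] is the inner solution
    at [plam w]. *)
Definition lyapunov wstar w v : R :=
  lagr (plam w) w + lagr (plam w) wstar - 2 * lagr (plam w) v.

(** [kappa] is the constant of [sweep_cost_to_go] and [Gam] that of
    [dual_gap_upper].  The primal gap is multiplied by [qV] and the dual gap by
    [qD]; the bound [beta / 4] on [tau] makes the second-order term harmless, and
    [beta / (6 (1 + kappa))] keeps [qV] below 1. *)
Lemma lyapunov_contraction : exists2 taubar, 0 < taubar &
  forall tau, 0 < tau < taubar -> exists2 q, 0 < q < 1 &
  forall wstar w w' v v', critical wstar -> resid wstar = 0 ->
    nonneg_orthant (pz w) -> sweep (plam w) w w' ->
    plam w' = plam w - tau *: resid w' ->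
    inner_sol (plam w) v -> inner_sol (plam w') v' ->
    lyapunov wstar w' v' <= q * lyapunov wstar w v.
Proof.
have [kappa kappa0 hkappa] := sweep_cost_to_go.
have [Gam Gam0 hGam] := dual_gap_upper.
have k1 : 0 < 1 + kappa by rewrite addr_gt0.
exists (Num.min (beta / 4) (beta / (6 * (1 + kappa)))).
  by rewrite lt_min !divr_gt0 // mulr_gt0.
move=> tau /andP[tau0]; rewrite lt_min => /andP[tau_b tau_k].
set qV := (1 + 3 * tau / beta) * (kappa / (1 + kappa)).
set qD := 1 - tau / (2 * Gam).
have qV0 : 0 < qV.
  by rewrite mulr_gt0 ?divr_gt0 // addr_gt0 // divr_gt0 // mulr_gt0.
have qV1 : qV < 1.
  rewrite /qV mulrA ltr_pdivrMr // mul1r.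
  have h : 3 * tau / beta * (1 + kappa) < 1 / 2.
    rewrite ltr_pdivlMr ?mulr_gt0 // in tau_k.
    by rewrite mulrAC ltr_pdivrMr //; lra.
  have s0 : 0 < 3 * tau / beta by rewrite divr_gt0 // mulr_gt0.
  by move: h s0; move: (3 * tau / beta) => s h s0; lra.
have qD1 : qD < 1 by rewrite /qD ltrBlDr ltrDl divr_gt0 // mulr_gt0.
exists (Num.max qV qD); first by rewrite lt_max qV0 gt_max qV1 qD1.
move=> wstar w w' v v' crit_s res_s w_ge0 sw lamw' sol_v sol_v'.
have s_ge0 : nonneg_orthant (pz wstar) by case: crit_s => _ _ [].
have w'_ge0 : nonneg_orthant (pz w') by case: sw => _ _ [].
have v_ge0 : nonneg_orthant (pz v) by case: sol_v => -[_ _ []].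
have D_le := hGam _ _ _ sol_v crit_s res_s.
have Vp_le := hkappa _ _ _ _ w_ge0 sw v_ge0.
have asc := dual_ascent sol_v sol_v'.
have dlam : plam w - plam w' = tau *: resid w'.
  by rewrite lamw' opprB addrC subrK.
rewrite dlam sqnZ dotZl in asc.
have Vp_lam : lagr (plam w') w' = lagr (plam w) w' + tau * sqn (resid w').
  by rewrite lamw' /lagr dotDl dotNl dotZl -/(sqn _); ring.
have D_lam : lagr (plam w') wstar = lagr (plam w) wstar.
  by rewrite !(lagr_feasible _ res_s).
have eE : sqn (resid w' - resid v) =
    sqn (resid w') - 2 * dot (resid w') (resid v) + sqn (resid v).
  by rewrite sqnD sqnN dotNr; ring.
have rp_le := sqnD_le (resid w' - resid v) (resid v); rewrite subrK in rp_le.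
rewrite /lyapunov Vp_lam D_lam.
have V0 : 0 <= lagr (plam w) w - lagr (plam w) v.
  by rewrite subr_ge0 inner_sol_le.
have D0 : 0 <= lagr (plam w) wstar - lagr (plam w) v.
  by rewrite subr_ge0 inner_sol_le.
have e_le : beta / 2 * sqn (resid w' - resid v) <=
    lagr (plam w) w' - lagr (plam w) v.
  by rewrite lerBrDl inner_sol_resid.
clear dlam Vp_lam D_lam lamw' hkappa hGam.
move: eE rp_le D_le asc e_le V0 D0 Vp_le.
have := sqn_ge0 (resid w'); have := sqn_ge0 (resid v).
have := sqn_ge0 (resid w' - resid v).
move: (sqn (resid w' - resid v)) (sqn (resid w')) (sqn (resid v)) (dot _ _).
move: (lagr (plam w) w) (lagr (plam w) w') (lagr (plam w) v).
move: (lagr (plam w) wstar) (lagr (plam w') v').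
move=> Ls d' Lw Lw' d e rp r p e0 r0 rp0 eE rp_le D_le asc e_le V0 D0 Vp_le.
set V := Lw - d; set D := Ls - d; set Vp := Lw' - d.
(* Change of multiplier: ascent of [d] against the increase of the Lagrangian. *)
have step1 : Lw' + tau * rp + Ls - 2 * d' <=
    Vp + D + tau * (e - r) + tau ^+ 2 / beta * rp.
  have -> : tau ^+ 2 / beta * rp = 2 * ((2 * beta)^-1 * (tau ^+ 2 * rp)).
    by field; rewrite gt_eqF.
  rewrite eE /Vp /D; lra.
have step2 : tau ^+ 2 / beta * rp <= tau / 2 * (e + r).
  have h : tau ^+ 2 / beta <= tau / 4.
    rewrite ler_pdivrMr // expr2 mulrAC -mulrA ler_pM2l //; lra.
  apply: le_trans (ler_wpM2r rp0 h) _.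
  have tau4 : 0 < tau / 4 by rewrite divr_gt0.
  by apply: le_trans (ler_wpM2l (ltW tau4) rp_le) _; lra.
have step3 : tau * 3 / 2 * e <= 3 * tau / beta * Vp.
  have h : e <= 2 / beta * Vp.
    by rewrite mulrAC ler_pdivlMr // /Vp; lra.
  have t3 : 0 < tau * 3 / 2 by rewrite divr_gt0 // mulr_gt0.
  apply: le_trans (ler_wpM2l (ltW t3) h) _.
  rewrite le_eqVlt; apply/orP; left; apply/eqP.
  by field; rewrite gt_eqF.
have step4 : tau / (2 * Gam) * D <= tau / 2 * r.
  have k0 : 0 < tau / (2 * Gam) by positivity.
  have -> : tau / 2 * r = tau / (2 * Gam) * (Gam * r).
    by field; rewrite gt_eqF.
  by rewrite ler_pM2l.
have step5 : (1 + 3 * tau / beta) * Vp <= qV * V.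
  rewrite /qV -[leRHS]mulrA ler_pM2l; last by positivity.
  by rewrite mulrAC ler_pdivlMr // /Vp /V; lra.
have mV : qV * V <= Num.max qV qD * V by rewrite ler_wpM2r // le_max lexx.
have mD : qD * D <= Num.max qV qD * D by rewrite ler_wpM2r // le_max lexx orbT.
have -> : Lw + Ls - 2 * d = V + D by rewrite /V /D; ring.
rewrite mulrDr; rewrite /qD in mD; lra.
Qed.

(** Quadratic growth around the inner solution bounds the distance of both [w]
    and [wstar] to it by the two gaps; [z] is recovered from [x], [y] and the
    residual, and the multiplier by [multiplier_lipschitz]. *)
Lemma lyapunov_error : exists2 C, 0 < C & forall wstar w v,
  critical wstar -> resid wstar = 0 -> nonneg_orthant (pz w) ->
  inner_sol (plam w) v ->
  sqn (stack w - stack wstar) <= C * lyapunov wstar w v.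
Proof.
have [C C0 hC] := multiplier_lipschitz.
have [a a0 ha] := mulmx_bounded A; have [c c0 hc] := mulmx_bounded B.
have cF0 := sc_gt0 scF; have cG0 := sc_gt0 scG.
set C1 := 1 / cF; set C2 := 1 / cG; set C3 := 2 / beta.
have [C10 C20 C30] : [/\ 0 < C1, 0 < C2 & 0 < C3] by split; positivity.
have close lam u v : inner_sol lam v -> nonneg_orthant (pz u) ->
    [/\ sqn (px u - px v) <= C1 * (lagr lam u - lagr lam v),
        sqn (py u - py v) <= C2 * (lagr lam u - lagr lam v) &
        sqn (resid u - resid v) <= C3 * (lagr lam u - lagr lam v)].
  move=> solv u_ge0; have := inner_sol_min solv u_ge0.
  have := mulr_ge0 (ltW cF0) (sqn_ge0 (px u - px v)).
  have := mulr_ge0 (ltW cG0) (sqn_ge0 (py u - py v)).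
  have := mulr_ge0 (ltW beta_gt0) (sqn_ge0 (resid u - resid v)).
  by split; rewrite /C1 /C2 /C3 mulrAC ler_pdivlMr //; lra.
set Cz := 2 * C3 + 4 * a * C1 + 4 * c * C2.
have closez lam u v : inner_sol lam v -> nonneg_orthant (pz u) ->
    sqn (pz u - pz v) <= Cz * (lagr lam u - lagr lam v).
  move=> solv u_ge0; have [hx hy hr] := close _ _ _ solv u_ge0.
  have -> : pz u - pz v = (resid u - resid v) +
      (- (A *m (px u - px v)) - B *m (py u - py v)).
    by rewrite residB; vec_ring.
  have := sqnD_le (resid u - resid v)
    (- (A *m (px u - px v)) - B *m (py u - py v)).
  have := sqnD_le (- (A *m (px u - px v))) (- (B *m (py u - py v))).
  rewrite !sqnN; have := ha (px u - px v); have := hc (py u - py v).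
  have := ler_wpM2l (ltW a0) hx; have := ler_wpM2l (ltW c0) hy.
  rewrite /Cz; move: (lagr lam u - lagr lam v) hr => g; lra.
set Cl := (2 * C + 2 * beta ^+ 2) * C3.
exists (2 * C1 + 2 * C2 + 2 * Cz + Cl); first by rewrite /Cz /Cl; positivity.
move=> wstar w v crit_s res_s w_ge0 solv.
have s_ge0 : nonneg_orthant (pz wstar) by case: crit_s => _ _ [].
have [xw yw _] := close _ _ _ solv w_ge0; have zw := closez _ _ _ solv w_ge0.
have [xs ys rs] := close _ _ _ solv s_ge0; have zs := closez _ _ _ solv s_ge0.
have lam_le : sqn (plam w - plam wstar) <=
    Cl * (lagr (plam w) wstar - lagr (plam w) v).
  have -> : plam w - plam wstar = (plam v - plam wstar) + beta *: resid v.
    by case: solv => _ ->; vec_ring.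
  apply: le_trans (sqnD_le _ _) _; rewrite sqnZ.
  have := hC _ _ (proj1 solv) crit_s; move: rs; rewrite res_s subr0 sub0r sqnN.
  have h : 0 < 2 * C + 2 * beta ^+ 2 by positivity.
  move=> /(ler_wpM2l (ltW h)); rewrite /Cl; lra.
rewrite /stack !opp_col_mx !add_col_mx !sqn_col_mx.
have := sqn_triangle (px w) (px v) (px wstar).
have := sqn_triangle (py w) (py v) (py wstar).
have := sqn_triangle (pz w) (pz v) (pz wstar).
have V0 : 0 <= lagr (plam w) w - lagr (plam w) v.
  by rewrite subr_ge0 inner_sol_le.
have Cl0 : 0 < Cl by rewrite /Cl; positivity.
have -> : lyapunov wstar w v = (lagr (plam w) w - lagr (plam w) v)
  + (lagr (plam w) wstar - lagr (plam w) v) by rewrite /lyapunov; ring.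
have := mulr_ge0 (ltW Cl0) V0; move: V0 xw yw zw xs ys zs lam_le.
move: (lagr (plam w) w - _) (lagr (plam w) wstar - _) => V D; lra.
Qed.

(** Without residuals [multiplier_lipschitz] forces equal multipliers, then
    [critical_monotone] equal [x] and [y]. *)
Lemma kkt_unique w v : critical w -> resid w = 0 -> critical v -> resid v = 0 ->
  w = v.
Proof.
move=> cw rw cv rv; have [C C0 hC] := multiplier_lipschitz.
have lam_eq : plam w = plam v.
  apply/eqP; rewrite -subr_eq0; apply/eqP/sqn_eq0.
  by have := hC _ _ cw cv; rewrite rw rv subrr sqn0 mulr0.
have := critical_monotone cw cv; rewrite rw rv subrr dot0r.
have cF0 := sc_gt0 scF; have cG0 := sc_gt0 scG.
have hx := mulr_ge0 (ltW cF0) (sqn_ge0 (px w - px v)).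
have hy := mulr_ge0 (ltW cG0) (sqn_ge0 (py w - py v)) => h.
have x_eq : px w = px v.
  apply/eqP; rewrite -subr_eq0; apply/eqP/sqn_eq0.
  by rewrite -(pmulr_rle0 _ cF0); lra.
have y_eq : py w = py v.
  apply/eqP; rewrite -subr_eq0; apply/eqP/sqn_eq0.
  by rewrite -(pmulr_rle0 _ cG0); lra.
have z_eq : pz w = pz v.
  have := residB v w; rewrite rw rv x_eq y_eq !subrr !mulmx0 !add0r.
  by move/esym/eqP; rewrite subr_eq0 => /eqP.
by case: w v x_eq y_eq z_eq lam_eq {cw rw cv rv h hx hy} =>
  ? ? ? ? [? ? ? ?] /= -> -> -> ->.
Qed.

End FullRank.
End Lagrangian.

(** * R-linear convergence *)

Lemma R_linear_of_sqn {R : realType} {n : nat} (w : nat -> 'cV[R]_n) wstar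
    (C q : R) : 0 < q < 1 -> (forall k, sqn (w k - wstar) <= C * q ^+ k) ->
  R_linear_cvg w wstar.
Proof.
move=> /andP[q0 q1] h; exists (Num.sqrt C), (Num.sqrt q); split.
  by rewrite sqrtr_gt0 q0 -sqrtr1 ltr_sqrt.
move=> k; have C0 : 0 <= C.
  by have := le_trans (sqn_ge0 _) (h 0%N); rewrite expr0 mulr1.
have rho_k : Num.sqrt q ^+ k = Num.sqrt (q ^+ k).
  have -> : q ^+ k = (Num.sqrt q ^+ k) ^+ 2 by rewrite exprAC sqr_sqrtr // ltW.
  by rewrite sqrtr_sqr ger0_norm // exprn_ge0 // sqrtr_ge0.
by rewrite rho_k -sqrtrM //; apply: ler_wsqrtr; exact: h.
Qed.

Theorem proposition3p1 (R : realType) (nx ny m : nat)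
  (A : 'M[R]_(m, nx)) (B : 'M[R]_(m, ny)) (b : 'cV[R]_m)
  (F : 'cV[R]_nx -> R) (G : 'cV[R]_ny -> R) (muF muG LF LG : R)
  (muF_gt0 : 0 < muF) (muG_gt0 : 0 < muG)
  (F_C1 : cont_differentiable F) (G_C1 : cont_differentiable G)
  (F_sc : strongly_convex muF F) (G_sc : strongly_convex muG G)
  (F_lip : lipschitz_grad LF F) (G_lip : lipschitz_grad LG G)
  (AB_full : row_free (row_mx A B)) :
  exists wstar : pd_point R nx ny m,
    unique (is_kkt F G A B b) wstar /\
    forall beta : R, 0 < beta ->
      exists taubar : R, 0 < taubar /\
        forall tau : R, 0 < tau < taubar ->
          forall w0 : pd_point R nx ny m, nonneg_orthant (pz w0) ->
            (exists w : nat -> pd_point R nx ny m,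
               admm_run F G A B b beta tau w0 w) /\
            (forall w : nat -> pd_point R nx ny m,
               admm_run F G A B b beta tau w0 w ->
               R_linear_cvg (fun k => stack (w k)) (stack wstar)).
Proof.
have scF := smooth_sc_grad muF_gt0 F_C1 F_sc F_lip.
have scG := smooth_sc_grad muG_gt0 G_C1 G_sc G_lip.
have kktE w : is_kkt F G A B b w <->
    @critical _ _ _ _ (grad F) (grad G) A B w /\ @resid _ _ _ _ A B b w = 0.
  split=> [[hx hy hr _ hz]|[[hx hy hz] hr]]; split => //.
  - by rewrite /resid /residual hr subrr.
  - by apply/eqP; rewrite -subr_eq0; apply/eqP.
  - by case: hz.
have [ws [crit_s res_s]] := kkt_exists scF scG b AB_full.
exists ws; split.
  split; first by apply/kktE.
  move=> v /kktE[cv rv].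
  exact: (kkt_unique scF scG AB_full crit_s res_s cv rv).
move=> beta beta0.
have [taubar taubar0 contr] := lyapunov_contraction scF scG b beta0 AB_full.
exists taubar; split => // tau tau_in w0 w0_ge0.
have step_ge0 w w' : nonneg_orthant (pz w) ->
    admm_step F G A B b beta tau w w' -> nonneg_orthant (pz w').
  by move=> w_ge0 /(admm_stepE scF scG b beta0 _ _ w_ge0)[[_ _ []]].
split.
  have total w : exists w' : pd_point R nx ny m,
      nonneg_orthant (pz w) -> admm_step F G A B b beta tau w w'.
    have [w_ge0|w_neg] := pselect (nonneg_orthant (pz w)).
      have [w' step_w] := sweep_exists scF scG b (A := A) (B := B) beta0
        (plam w) tau w.
      by exists w' => _; apply/(admm_stepE scF scG b beta0 tau w' w_ge0).
    by exists w.
  have [next nextP] := choice total.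
  have iter_ge0 k : nonneg_orthant (pz (iter k next w0)).
    by elim: k => // k IHk; apply: step_ge0 IHk (nextP _ IHk).
  by exists (fun k => iter k next w0); split => // k; apply: nextP.
move=> w [w_0 w_step].
have w_ge0 k : nonneg_orthant (pz (w k)).
  by elim: k => [|k IHk]; [rewrite w_0|apply: step_ge0 IHk (w_step k)].
have [C C0 err] := lyapunov_error scF scG b beta0 AB_full.
have [q q01 decr] := contr tau tau_in.
have [v0 sol0] := inner_sol_exists scF scG b beta0 AB_full (plam (w 0%N)).
pose Phi := lyapunov (F := F) (G := G) (A := A) (B := B) b (beta := beta) ws.
have decay k : exists2 v,
    inner_sol (gF := grad F) (gG := grad G) (A := A) (B := B) b (beta := beta)
      (plam (w k)) v &
    Phi (w k) v <= q ^+ k * Phi (w 0%N) v0.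
  elim: k => [|k [v sol le_v]]; first by exists v0; rewrite // expr0 mul1r.
  have [v' sol'] := inner_sol_exists scF scG b beta0 AB_full (plam (w k.+1)).
  exists v' => //.
  have /(admm_stepE scF scG b beta0 _ _ (w_ge0 k))[sw lam_k] := w_step k.
  apply: le_trans (decr _ _ _ _ _ crit_s res_s (w_ge0 k) sw lam_k sol sol') _.
  by rewrite exprS -mulrA ler_pM2l //; case/andP: q01.
apply: (R_linear_of_sqn (C := C * Phi (w 0%N) v0) q01) => k.
have [v sol le_v] := decay k.
apply: le_trans (err _ _ _ crit_s res_s (w_ge0 k) sol) _.
by rewrite -mulrA ler_pM2l // mulrC.
Qed.
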